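(* Let $R=(r_1,\dots,r_n)$ and $S=(s_1,\dots,s_n)$ be vectors of real numbers with $\sum_i r_i=\sum_j s_j$. Then $\mathcal{T}^{-1}(R,S)\neq\emptyset$ if and only if $R=S$. The same is true for $\mathcal{T}^{-1}_{\mathbb{Z}}(R,S)$: if $R$ and $S$ have nonnegative integer components, then $\mathcal{T}^{-1}_{\mathbb{Z}}(R,S)\neq\emptyset$ if and only if $R=S$.
   Context: $\mathcal{T}(R,S)$ is the set of $n\times n$ matrices with nonnegative real entries whose $i$th row sum is $r_i$ and whose $j$th column sum is $s_j$ for all $i,j$. The reflection $r_{-1}$ (in the line of slope $-1$) acts on $n\times n$ matrices as ordinary transposition. $\mathcal{T}^{-1}(R,S)$ is the set of $A\in\mathcal{T}(R,S)$ with $r_{-1}A=A$, i.e. $A^t=A$; $\mathcal{T}^{-1}_{\mathbb{Z}}(R,S)$ is the set of those $A\in\mathcal{T}^{-1}(R,S)$ all of whose entries are integers.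
   Formalization: For the real case, the components of R and S are assumed nonnegative; without this the claim fails, e.g. n = 1 and R = S = (-1), where no nonnegative matrix has the required row sum. *)

(* Defs.v *)
From mathcomp Require Import all_boot all_order all_algebra.
From mathcomp Require Import classical_sets reals.

Set Implicit Arguments.
Unset Strict Implicit.
Unset Printing Implicit Defensive.
Import Order.TTheory GRing.Theory Num.Theory.
Local Open Scope ring_scope.
Local Open Scope classical_set_scope.

Definition transport (R : realType) (n : nat) (r s : 'rV[R]_n) :
    set 'M[R]_n :=
  [set A | [/\ forall i j, 0 <= A i j,
               forall i, \sum_j A i j = r 0 i &
               forall j, \sum_i A i j = s 0 j]].

(* The reflection in the line of slope -1, i.e. in the main diagonal: row
   indices increase downwards. *)
Definition reflect_m1 (R : realType) (n : nat) (A : 'M[R]_n) : 'M[R]_n := A^T.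

Definition transport_m1 (R : realType) (n : nat) (r s : 'rV[R]_n) :
    set 'M[R]_n :=
  [set A | transport r s A /\ reflect_m1 A = A].

Definition transport_m1_int (R : realType) (n : nat) (r s : 'rV[R]_n) :
    set 'M[R]_n :=
  [set A | transport_m1 r s A /\ forall i j, A i j \is a Num.int].

(* Main.v *)
Require Import Defs.
From mathcomp Require Import all_boot all_order all_algebra.
From mathcomp Require Import classical_sets reals.

Set Implicit Arguments.
Unset Strict Implicit.
Unset Printing Implicit Defensive.
Import Order.TTheory GRing.Theory Num.Theory.
Local Open Scope ring_scope.
Local Open Scope classical_set_scope.

(** Transposition exchanges row sums and column sums, so a symmetric matrix has equal margins
    ([transport_m1_margins_eq]). Conversely, when the margins agree, [diag_mx r] is a symmetric
    matrix with both margins [r]; its entries are nonnegative, or integral, as soon as those of [r]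
    are. One witness thus settles both the real and the integer claim. *)

Lemma diag_mx_transport_m1 (R : realType) (n : nat) (r : 'rV[R]_n) :
  (forall i, 0 <= r 0 i) -> transport_m1 r r (diag_mx r).
Proof.
have row_sum i : \sum_j diag_mx r i j = r 0 i.
  rewrite (bigD1 i) //= big1 => [|j ji]; first by rewrite !mxE eqxx addr0.
  by rewrite mxE eq_sym (negPf ji).
move=> r_ge0; split; last exact: tr_diag_mx.
split=> // [i j|j]; first by rewrite mxE mulrn_wge0.
(* By symmetry of [diag_mx r], column [j] is row [j], whose sum is already known. *)
rewrite -[RHS]row_sum; apply: eq_bigr => i _.
by rewrite -[in LHS]tr_diag_mx mxE.
Qed.

(** Row [i] of a symmetric matrix coincides with its column [i], entry by entry. *)
Lemma transport_m1_margins_eq (R : realType) (n : nat) (r s : 'rV[R]_n)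
    (A : 'M[R]_n) :
  transport_m1 r s A -> r = s.
Proof.
move=> [[_ row_sum col_sum] A_sym]; apply/rowP => i.
rewrite -row_sum -col_sum; apply: eq_bigr => j _.
by rewrite -[in LHS]A_sym mxE.
Qed.

Theorem theorem3 (R : realType) (n : nat) (r s : 'rV[R]_n) :
  \sum_i r 0 i = \sum_j s 0 j ->
  ((forall i, 0 <= r 0 i) -> (forall j, 0 <= s 0 j) ->
     (transport_m1 r s !=set0 <-> r = s)) /\
  ((forall i, r 0 i \is a Num.nat) -> (forall j, s 0 j \is a Num.nat) ->
     (transport_m1_int r s !=set0 <-> r = s)).
Proof.
move=> _; split=> [r_ge0 _|r_nat _]; split.
- by move=> [A /transport_m1_margins_eq].
- by move=> <-; exists (diag_mx r); apply: diag_mx_transport_m1.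
- by move=> [A [/transport_m1_margins_eq]].
move=> <-; exists (diag_mx r); split.
  by apply: diag_mx_transport_m1 => i; apply: natr_ge0.
(* The entry is [r 0 i *+ (i == j)], a natural multiple of an integer. *)
by move=> i j; rewrite mxE rpredMn // intr_nat.
Qed.
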